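(* Suppose that for every $\alpha>0$ we have $pn^\alpha\to\infty$ as $n\to\infty$, and that $q\ln n\to\infty$, where $q=1-p$. Then for every $\varepsilon>0$ there exists $n_0$ such that for all $n\ge n_0$, both $u_3(n,p)$ and $u_3'(n,p)$ are at least $(2-\varepsilon)\log_{\frac{1}{1-p}}(np)$.
   Context: $G(n,p)$ is the Erdős–Rényi random graph on $n$ labelled vertices (vertex set $V$), each edge present independently with probability $p=p(n)$; $\mathbb{P}_{n,p}$ is the corresponding probability and $q=1-p$. A diameter graph in $\mathbb{R}^d$ is a graph $(V,E)$ with $V\subset\mathbb{R}^d$ finite and $E=\{\{\mathbf{x},\mathbf{y}\}\subseteq V: |\mathbf{x}-\mathbf{y}|=\operatorname{diam}V\}$, where $\operatorname{diam}V=\max_{\mathbf{x},\mathbf{y}\in V}|\mathbf{x}-\mathbf{y}|$ (Euclidean norm); a graph is a diameter graph in $\mathbb{R}^d$ if it is isomorphic to one. $u_d(n,p)$ is the largest positive integer $k$ such that $\mathbb{P}_{n,p}\big(\exists W\subseteq V,\ |W|=k,\ G[W]$ is a diameter graph in $\mathbb{R}^d$ and $\chi(G[W])=d+1\big)>\frac12$, where $G[W]$ is the induced subgraph; if no such $k$ exists, $u_d(n,p)=0$. $u_d'(n,p)$ is defined identically with the additional requirement that $G[W]$ be connected. *)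

(* Defs.v *)
From HB Require Import structures.
From Stdlib Require Import Reals ClassicalEpsilon.
From mathcomp Require Import all_boot.

Set Implicit Arguments.
Unset Strict Implicit.
Unset Printing Implicit Defensive.
Local Open Scope R_scope.

(* A labelled graph on vertex set 'I_n: only the entries g (i,j) with i < j
   are meaningful (one bit per unordered pair). *)
Definition graph (n : nat) := {ffun 'I_n * 'I_n -> bool}.

Definition adj (n : nat) (g : graph n) : rel 'I_n :=
  fun i j => if (i < j)%N then g (i, j) else if (j < i)%N then g (j, i) else false.

Definition canonical_graph (n : nat) (g : graph n) : bool :=
  [forall x : 'I_n * 'I_n, ~~ (x.1 < x.2)%N ==> ~~ g x].

Definition gnp_weight (n : nat) (p : R) (g : graph n) : R :=
  \big[Rmult/1]_(x : 'I_n * 'I_n | (x.1 < x.2)%N) (if g x then p else (1 - p)).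

Definition gnp_prob (n : nat) (p : R) (E : graph n -> Prop) : R :=
  \big[Rplus/0]_(g : graph n | canonical_graph g)
     (if excluded_middle_informative (E g) then gnp_weight p g else 0).

Definition edist (d : nat) (x y : 'I_d -> R) : R :=
  sqrt (\big[Rplus/0]_(i < d) ((x i - y i) * (x i - y i))).

Definition is_diameter_graph (d n : nat) (g : graph n) (W : {set 'I_n}) : Prop :=
  exists f : 'I_n -> ('I_d -> R),
    {in W &, injective f} /\
    exists D : R,
      (forall x y, x \in W -> y \in W -> (edist (f x) (f y) <= D)) /\
      (exists x y, x \in W /\ y \in W /\ edist (f x) (f y) = D) /\
      (forall x y, x \in W -> y \in W -> x <> y ->
         (adj g x y <-> edist (f x) (f y) = D)).

Definition colorable (n : nat) (g : graph n) (W : {set 'I_n}) (k : nat) : Prop :=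
  exists c : 'I_n -> nat,
    (forall x, x \in W -> (c x < k)%N) /\
    (forall x y, x \in W -> y \in W -> adj g x y -> c x <> c y).

Definition chromatic_number_is (n : nat) (g : graph n) (W : {set 'I_n}) (m : nat) : Prop :=
  colorable g W m /\ (forall m', colorable g W m' -> (m <= m')%N).

Definition connected_on (n : nat) (g : graph n) (W : {set 'I_n}) : Prop :=
  forall x y, x \in W -> y \in W ->
    connect (fun a b => [&& a \in W, b \in W & adj g a b]) x y.

Definition event_u (d n k : nat) (g : graph n) : Prop :=
  exists W : {set 'I_n}, #|W| = k /\ is_diameter_graph d g W /\
                         chromatic_number_is g W d.+1.

Definition event_u' (d n k : nat) (g : graph n) : Prop :=
  exists W : {set 'I_n}, #|W| = k /\ is_diameter_graph d g W /\
                         chromatic_number_is g W d.+1 /\ connected_on g W.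

(* u_d(n,p): largest k with probability > 1/2, or 0. Since |W| = k <= n,
   only k <= n can have positive probability. *)
Definition u (d n : nat) (p : R) : nat :=
  \max_(k < n.+1) (if Rlt_dec (1/2) (gnp_prob p (@event_u d n k)) then val k else 0%N).

Definition u' (d n : nat) (p : R) : nat :=
  \max_(k < n.+1) (if Rlt_dec (1/2) (gnp_prob p (@event_u' d n k)) then val k else 0%N).

(* Main.v *)
(** Second moment method. Cut the vertices into k blocks of equal size M and pick
    one vertex per block, asking that the picked vertices induce a fixed template:
    an apex (block 0) joined to all the others, a triangle on blocks 1, 2, 3, and
    no further edge. The template contains K_4, is connected and 4-colourable, and
    it is a diameter graph in R^3: take a regular tetrahedron and put the remaining
    points on an arc of the sphere of radius [diam] centred at the apex, inside the
    spherical triangle of the other three vertices.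

    Two choices share an edge of the template exactly when they agree in two blocks,
    so with l agreements their joint probability exceeds the product by a factor at
    most Y^l, where Y = p^-4 q^(-k/2). As agreements are independent between blocks,
    E Z^2 <= (1 + Y/M)^k (E Z)^2 for the number Z of good choices. For k about
    (2 - eps) log_{1/q}(np), Y is at most n^(1 - eps/2 + o(1)), so k Y / M -> 0. *)

Require Import Defs.
From Stdlib Require Import ZArith Reals Lra ClassicalEpsilon.
From mathcomp Require Import all_boot all_order all_algebra.
From mathcomp Require Import Rstruct.
Set Implicit Arguments.
Unset Strict Implicit.
Unset Printing Implicit Defensive.
Import Order.TTheory GRing.Theory Num.Theory.

(** * Probability that a set of blocks induces the template *)

Local Open Scope ring_scope.

Definition edge_prob (p : R) (b : bool) : R := if b then p else 1 - p.

(** Independence of the edges: the weight is a product over pairs, so the sum over graphs factors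
    pair by pair. A pair outside [S] contributes [p + (1 - p) = 1]. *)
Lemma gnp_cylinder (n : nat) (p : R) (S : {set 'I_n * 'I_n}) (t : 'I_n * 'I_n -> bool) :
  (forall x, x \in S -> (x.1 < x.2)%N) ->
  \sum_(g : graph n | canonical_graph g)
     (if [forall x in S, g x == t x] then gnp_weight p g else 0) =
  \prod_(x in S) edge_prob p (t x).
Proof.
move=> hS.
(* The constraint moves inside the product: a violated entry contributes a factor 0. *)
pose F x b := if (x \in S) && (b != t x) then 0 else edge_prob p b.
transitivity (\sum_(g : graph n | canonical_graph g)
                \prod_(x : 'I_n * 'I_n | (x.1 < x.2)%N) F x (g x)).
  apply: eq_bigr => g _; case: ifPn => [/forall_inP hg|].
    apply: eq_bigr => x _; rewrite /F.
    by case xS: (x \in S); rewrite ?(eqP (hg _ xS)) ?eqxx.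
  rewrite negb_forall => /existsP[x]; rewrite negb_imply => /andP[xS gx].
  by rewrite (bigD1 x) ?hS //= /F xS gx mul0r.
(* Canonical graphs are exactly the functions equal to [false] outside the pairs [i < j], the index
   set required for distributing a product over sums. *)
have -> : \sum_(g : graph n | canonical_graph g)
                \prod_(x : 'I_n * 'I_n | (x.1 < x.2)%N) F x (g x) =
   \sum_(g in pfamily false (fun x : 'I_n * 'I_n => (x.1 < x.2)%N) (fun=> predT))
                \prod_(x : 'I_n * 'I_n | (x.1 < x.2)%N) F x (g x).
  apply: eq_bigl => g; apply/forallP/pfamilyP => [hg|[hg _] x].
    split=> // ; apply/supportP => x; rewrite unfold_in => hx.
    by move: (hg x); rewrite hx /=; case: (g x).
  by apply/implyP => hx; rewrite (supportP hg).
rewrite -big_distr_big_dep [RHS](big_mkcond) [LHS]big_mkcond /=.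
apply: eq_bigr => x _; rewrite big_bool /F /edge_prob.
case: ifP => hx; last first.
  by case: ifP => // xS; rewrite hS in hx.
by case: (x \in S) => /=; case: (t x) => /=; rewrite ?addr0 ?add0r // addrC subrK.
Qed.

(** Meant for [a < b]: the condition [b < 4] then puts both indices in the K_4 on blocks 0 to 3. *)
Definition template (a b : nat) : bool := (a == 0)%N || (b < 4)%N.

Definition block_template (n M : nat) (x : 'I_n * 'I_n) : bool :=
  template (x.1 %/ M) (x.2 %/ M).

(** * Choices of one vertex per block *)

Lemma emb_proof (n k M : nat) (le_n : (k * M <= n)%N) (a : 'I_k) (x : 'I_M) :
  (a * M + x < n)%N.
Proof.
apply: leq_trans le_n; apply: leq_trans (_ : (a.+1 * M <= _)%N).
  by rewrite mulSnr ltn_add2l.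
by rewrite leq_mul2r ltn_ord orbT.
Qed.

(** Block [a] is the interval of length [M] starting at [a * M], so quotient and remainder by [M]
    recover the block and the choice made in it. *)
Definition emb (n k M : nat) (le_n : (k * M <= n)%N) (f : {ffun 'I_k -> 'I_M})
  (a : 'I_k) : 'I_n := Ordinal (emb_proof le_n a (f a)).

Lemma emb_div n k M (le_n : (k * M <= n)%N) f a : (emb le_n f a %/ M)%N = a.
Proof.
have M0 : (0 < M)%N by apply: leq_ltn_trans (ltn_ord (f a)).
by rewrite /= divnMDl // divn_small // addn0.
Qed.

Lemma emb_mod n k M (le_n : (k * M <= n)%N) f a : (emb le_n f a %% M)%N = f a.
Proof. by rewrite /= modnMDl modn_small. Qed.

Lemma emb_inj2 n k M (le_n : (k * M <= n)%N) f f' a b :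
  emb le_n f a = emb le_n f' b -> a = b /\ f a = f' a.
Proof.
move=> e; have ab : a = b by apply: val_inj; rewrite /= -(emb_div le_n f) e emb_div.
split=> //; apply: val_inj; rewrite /= -(emb_mod le_n f) e ab emb_mod //.
Qed.

Lemma emb_lt n k M (le_n : (k * M <= n)%N) f (a b : 'I_k) :
  (emb le_n f a < emb le_n f b)%N = (a < b)%N.
Proof.
have mono (c d : 'I_k) : (c < d)%N -> (emb le_n f c < emb le_n f d)%N.
  move=> cd; apply: leq_trans (_ : (d * M <= _)%N); last exact: leq_addr.
  apply: leq_trans (_ : (c.+1 * M <= _)%N); first by rewrite mulSnr ltn_add2l.
  by rewrite leq_mul2r cd orbT.
case: (ltngtP a b) => [/mono //|/mono h|/val_inj ->]; last by rewrite ltnn.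
by apply/negbTE; rewrite -leqNgt ltnW.
Qed.

Definition emb_pairs n k M (le_n : (k * M <= n)%N) (f : {ffun 'I_k -> 'I_M}) :
    {set 'I_n * 'I_n} :=
  [set (emb le_n f u.1, emb le_n f u.2) | u : 'I_k * 'I_k & (u.1 < u.2)%N].

Definition pair_prob (k : nat) (p : R) (u : 'I_k * 'I_k) : R :=
  edge_prob p (template u.1 u.2).

(** The predicate [P] is left general to serve both the pairs of a single choice and the pairs
    common to two choices. *)
Lemma prod_emb_pairs n k M (le_n : (k * M <= n)%N) (f : {ffun 'I_k -> 'I_M})
    (p : R) (P : pred ('I_k * 'I_k)) :
  \prod_(x in [set (emb le_n f u.1, emb le_n f u.2) | u : 'I_k * 'I_k & P u])
     edge_prob p (block_template M x) =
  \prod_(u : 'I_k * 'I_k | P u) pair_prob p u.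
Proof.
rewrite big_imset /=; last first.
  move=> [a b] [c d] _ _ e.
  by have [/= -> _] := emb_inj2 (congr1 fst e); have [/= -> _] := emb_inj2 (congr1 snd e).
rewrite (eq_bigl P) => [|u]; last by rewrite inE.
by apply: eq_bigr => u _; rewrite /block_template !emb_div.
Qed.

Lemma emb_pairsI n k M (le_n : (k * M <= n)%N) (f f' : {ffun 'I_k -> 'I_M}) :
  emb_pairs le_n f :&: emb_pairs le_n f' =
  [set (emb le_n f u.1, emb le_n f u.2) | u : 'I_k * 'I_k &
     [&& (u.1 < u.2)%N, f u.1 == f' u.1 & f u.2 == f' u.2]].
Proof.
apply/setP => x; rewrite inE; apply/andP/imsetP.
  move=> [/imsetP[[a b]] + -> /imsetP[[c d]]]; rewrite !inE /= => ab _ e.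
  have [/= _ fa] := emb_inj2 (congr1 fst e); have [/= _ fb] := emb_inj2 (congr1 snd e).
  exists (a, b) => //.
  by rewrite inE /= ab fa fb !eqxx.
move=> [[a b]]; rewrite inE /= => /and3P[ab /eqP fa /eqP fb] ->.
split; apply/imsetP; exists (a, b); rewrite ?inE //=.
by congr pair; apply: val_inj; rewrite /= ?fa ?fb.
Qed.

(* Each factor is at least q = s^2, and at least p q when u.1 < 4; a given second
   index occurs in at most four pairs of the latter kind. *)
Lemma prod_agree_ge (k : nat) (p s : R) (A : {set 'I_k}) :
  0 < p <= 1 -> 0 < s -> s ^+ 2 = 1 - p ->
  (p ^+ 4 * s ^+ k) ^+ #|A| <=
  \prod_(u : 'I_k * 'I_k | [&& (u.1 < u.2)%N, u.1 \in A & u.2 \in A]) pair_prob p u.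
Proof.
move=> /andP[p0 p1] s0 s2.
have s1 : s <= 1.
  by rewrite -(@ler_pXn2r _ 2) ?nnegrE ?(ltW s0) // expr1n s2 gerBl ltW.
have q0 : 0 < 1 - p by rewrite -s2 exprn_gt0.
pose P (u : 'I_k * 'I_k) := [&& (u.1 < u.2)%N, u.1 \in A & u.2 \in A].
apply: le_trans (_ : \prod_(u | P u) ((if (u.1 < 4)%N then p else 1) * s ^+ 2) <= _);
  last first.
  apply: ler_prod => u /and3P[u12 _ _].
  rewrite /pair_prob /edge_prob /template s2; apply/andP; split.
    by rewrite mulr_ge0 ?(ltW q0) //; case: ifP; rewrite ?ltW.
  case: ifP => a4; case: ifP => /= h.
  - by rewrite ler_piMr ?(ltW p0) // gerBl ltW.
  - by rewrite ler_piMl ?(ltW q0).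
  - by move: h; case/orP=> [/eqP h|h]; [rewrite h in a4 | rewrite (ltn_trans u12 h) in a4].
  - by rewrite mul1r.
rewrite big_split /= exprMn; apply: ler_pM; rewrite ?exprn_ge0 ?(ltW p0) ?(ltW s0) //.
  rewrite -exprM.
  rewrite (eq_bigr (fun u : 'I_k * 'I_k => p ^+ (u.1 < 4)%N)); last first.
    by move=> u _; case: ifP.
  rewrite -(big_morph (fun m : nat => p ^+ m) (exprD p) (expr0 p)).
  apply: ler_wiXn2l => //; first exact: ltW.
  (* The exponent of [p] is bounded by grouping pairs by second index: each [b] in [A] meets at most
     four first indices below 4. *)
  apply: leq_trans (_ : \sum_(b in A) \sum_(a : 'I_k) (a < 4)%N <= _)%N.
    rewrite exchange_big pair_big /= [leqRHS]big_mkcond [leqLHS]big_mkcond /=.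
    by apply: leq_sum => u _; case: ifP => // /and3P[_ _ ->].
  rewrite sum_nat_const mulnC leq_mul2r; apply/orP; right.
  rewrite -(big_mkord xpredT (fun a => nat_of_bool (a < 4)%N)).
  elim: k {A P} => [|k IH]; first by rewrite big_geq.
  case: (ltnP k 4) => hk.
    apply: leq_trans hk; rewrite -[leqRHS]muln1 -[X in (X * 1)%N]subn0 -sum_nat_const_nat.
    by apply: leq_sum => a _; case: (a < 4)%N.
  by rewrite big_nat_recr //= ltnNge hk addn0.
rewrite -exprM prodr_const -exprM; apply: ler_wiXn2l => //; first exact: ltW.
(* [P] and its mirror image [Q] are disjoint, equinumerous and contained in the square of [A]; hence
   twice the size of [P] is at most [#|A| * #|A|], and so at most [k * #|A|]. *)
apply: leq_trans (_ : #|A| * #|A| <= _)%N; last first.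
  by rewrite leq_mul2r; apply/orP; right; rewrite -[leqRHS]card_ord max_card.
pose Q (u : 'I_k * 'I_k) := [&& (u.2 < u.1)%N, u.1 \in A & u.2 \in A].
have cPQ : #|P| = #|Q|.
  pose sw (u : 'I_k * 'I_k) := (u.2, u.1).
  have swK : cancel sw sw by case.
  rewrite -!sum1_card (reindex sw) /=; last by exists sw => u _; apply: swK.
  by apply: eq_bigl => -[a b]; rewrite !unfold_in /= [(_ \in A) && _]andbC.
rewrite -cardsX mul2n -addnn [X in (_ + X)%N]cPQ.
rewrite -cardUI (eq_card0 (A := predI _ _)); last first.
  move=> -[a b]; rewrite !inE !unfold_in /=; apply/negbTE/negP.
  by move=> /andP[/andP[ab _] /andP[ba _]]; move: (ltn_trans ab ba); rewrite ltnn.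
rewrite addn0; apply: subset_leq_card; apply/subsetP => -[a b].
by rewrite !inE !unfold_in /= => /orP[] /and3P[_ -> ->].
Qed.

Definition induces n k M (le_n : (k * M <= n)%N) (f : {ffun 'I_k -> 'I_M})
  (g : graph n) : bool :=
  [forall x in emb_pairs le_n f, g x == block_template M x].

Lemma emb_pairs_lt n k M (le_n : (k * M <= n)%N) (f : {ffun 'I_k -> 'I_M}) x :
  x \in emb_pairs le_n f -> (x.1 < x.2)%N.
Proof. by move=> /imsetP[[a b]]; rewrite inE => ab ->; rewrite emb_lt. Qed.

Definition template_prob (k : nat) (p : R) : R :=
  \prod_(u : 'I_k * 'I_k | (u.1 < u.2)%N) pair_prob p u.

Lemma pair_prob_gt0 k p (u : 'I_k * 'I_k) : 0 < p < 1 -> 0 < pair_prob p u.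
Proof.
by rewrite /pair_prob /edge_prob => /andP[p0 p1]; case: ifP => _; rewrite ?subr_gt0.
Qed.

Lemma induces_prob n k M (le_n : (k * M <= n)%N) (f : {ffun 'I_k -> 'I_M}) p :
  \sum_(g : graph n | canonical_graph g) gnp_weight p g *+ induces le_n f g =
  template_prob k p.
Proof.
rewrite -[RHS](prod_emb_pairs le_n f) -gnp_cylinder; last exact: emb_pairs_lt.
by apply: eq_bigr => g _; rewrite mulrb.
Qed.

(** The joint event is a cylinder over the union of the two pair sets. Its probability is the
    product of the two probabilities divided by the weight of the common pairs, which
    [prod_agree_ge] bounds from below. *)
Lemma induces2_prob n k M (le_n : (k * M <= n)%N) (f f' : {ffun 'I_k -> 'I_M}) (p s : R) :
  0 < p < 1 -> 0 < s -> s ^+ 2 = 1 - p ->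
  \sum_(g : graph n | canonical_graph g)
     gnp_weight p g *+ (induces le_n f g && induces le_n f' g) <=
  template_prob k p ^+ 2 *
  \prod_(a : 'I_k) (if f a == f' a then (p ^+ 4 * s ^+ k)^-1 else 1).
Proof.
move=> p01 s0 s2; have /andP[p0 p1] := p01.
rewrite (eq_bigr (fun g : graph n => if [forall x in emb_pairs le_n f :|: emb_pairs le_n f',
    g x == block_template M x] then gnp_weight p g else 0)); last first.
  move=> g _; rewrite mulrb; congr (if _ then _ else _).
  apply/andP/forall_inP => [[/forall_inP h /forall_inP h'] x|h].
    by rewrite inE => /orP[/h|/h'].
  by split; apply/forall_inP => x xf; apply: h; rewrite inE xf ?orbT.
rewrite gnp_cylinder; last by move=> x; rewrite inE => /orP[] /emb_pairs_lt.
pose w (x : 'I_n * 'I_n) := edge_prob p (block_template M x) : R.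
set S := emb_pairs le_n f; set S' := emb_pairs le_n f'.
(* Inclusion-exclusion in product form; it avoids dividing by the weight of the intersection. *)
have wU : \prod_(x in S :|: S') w x * \prod_(x in S :&: S') w x =
          \prod_(x in S) w x * \prod_(x in S') w x.
  rewrite (big_setID S) /= setUK -mulrA; congr (_ * _).
  rewrite [RHS](big_setID S) /= mulrC setIC; congr (_ * _).
  by apply: eq_bigl => x; rewrite !inE; case: (x \in S).
have := @prod_agree_ge k p s [set a | f a == f' a].
rewrite p0 (ltW p1) => /(_ isT s0 s2).
set d := p ^+ 4 * s ^+ k => Ige.
have d0 : 0 < d by rewrite mulr_gt0 ?exprn_gt0.
have wI : \prod_(x in S :&: S') w x = \prod_(u : 'I_k * 'I_k | [&& (u.1 < u.2)%N,
    u.1 \in [set a | f a == f' a] & u.2 \in [set a | f a == f' a]]) pair_prob p u.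
  by rewrite emb_pairsI prod_emb_pairs; apply: eq_bigl => u; rewrite !inE.
rewrite -big_mkcond /= prodr_const -(ler_pM2r (exprn_gt0 #|[set a | f a == f' a]| d0)).
rewrite exprVn cardsE -!mulrA mulVf ?mulr1 ?expf_neq0 ?gt_eqF //.
rewrite {1}cardsE in Ige.
apply: le_trans (_ : \prod_(x in S :|: S') w x * \prod_(x in S :&: S') w x <= _).
  rewrite ler_wpM2l ?wI // prodr_ge0 // => x _; rewrite /w /edge_prob.
  by case: ifP => _; rewrite ?subr_ge0 ltW.
by rewrite wU !prod_emb_pairs.
Qed.

(** * Second moment of the number of good choices *)

(** The sum factors over blocks; in each block one value of [f'] agrees and contributes [y], the
    other [M - 1] contribute 1. *)
Lemma sum_agree k M (f : {ffun 'I_k -> 'I_M}) (y : R) : 0 <= y ->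
  \sum_(f' : {ffun 'I_k -> 'I_M}) \prod_(a : 'I_k) (if f a == f' a then y else 1) <=
  (M%:R + y) ^+ k.
Proof.
move=> y0; rewrite -(bigA_distr_bigA (fun a x => if f a == x then y else 1)) /=.
apply: le_trans (_ : \prod_(a : 'I_k) (M%:R + y) <= _); last first.
  by rewrite prodr_const card_ord.
apply: ler_prod => a _; apply/andP; split.
  by apply: sumr_ge0 => x _; case: ifP.
rewrite (bigD1 (f a)) //= eqxx addrC lerD2r.
rewrite (eq_bigr (fun=> 1)) => [|x]; last by rewrite eq_sym => /negbTE ->.
by rewrite sumr_const ler_nat -[leqRHS](card_ord M) max_card.
Qed.

Lemma gnp_weight_ge0 n p (g : graph n) : 0 <= p <= 1 -> 0 <= gnp_weight p g.
Proof.
move=> /andP[p0 p1].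
have -> : gnp_weight p g =
  \prod_(x : 'I_n * 'I_n | (x.1 < x.2)%N) edge_prob p (g x) by [].
by apply: prodr_ge0 => x _; rewrite /edge_prob; case: ifP => _; rewrite ?subr_ge0.
Qed.

(** With [Z] the number of choices inducing the template, E Z = m and E Z^2 <= c m^2, so Z > 0 has
    probability at least 1/c. Here [s] is the square root of [1 - p], which keeps the exponent k/2
    integral. *)
Lemma second_moment n k M (le_n : (k * M <= n)%N) (p s : R) :
  0 < p < 1 -> 0 < s -> s ^+ 2 = 1 - p -> (0 < M)%N ->
  ((1 + (p ^+ 4 * s ^+ k)^-1 / M%:R) ^+ k)^-1 <=
  \sum_(g : graph n | canonical_graph g)
    gnp_weight p g *+ [exists f : {ffun 'I_k -> 'I_M}, induces le_n f g].
Proof.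
move=> p01 s0 s2 M0; have /andP[p0 p1] := p01.
set y := (p ^+ 4 * s ^+ k)^-1; set c := (1 + _) ^+ k.
have y0 : 0 < y by rewrite invr_gt0 mulr_gt0 ?exprn_gt0.
have M0' : 0 < M%:R :> R by rewrite ltr0n.
have c0 : 0 < c by rewrite exprn_gt0 // ltr_wpDl // divr_gt0.
have t0 : 0 < template_prob k p.
  by apply: prodr_gt0 => u _; apply: pair_prob_gt0.
pose Z (g : graph n) : R := \sum_(f : {ffun 'I_k -> 'I_M}) 1 *+ induces le_n f g.
set m := (M%:R ^+ k * template_prob k p : R).
have m0 : 0 < m by rewrite mulr_gt0 ?exprn_gt0.
have EZ : \sum_(g : graph n | canonical_graph g) gnp_weight p g * Z g = m.
  under eq_bigr => g _ do rewrite mulr_sumr.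
  rewrite exchange_big /=.
  rewrite (eq_bigr (fun=> template_prob k p)) => [|f _]; last first.
    by rewrite -(induces_prob le_n f); apply: eq_bigr => g _; rewrite mulrnAr mulr1.
  by rewrite sumr_const card_ffun !card_ord -mulr_natl natrX.
have EZ2 : \sum_(g : graph n | canonical_graph g) gnp_weight p g * Z g ^+ 2 <= c * m ^+ 2.
  under eq_bigr => g _.
    rewrite expr2 mulr_suml mulr_sumr.
    under eq_bigr => f _ do rewrite mulr_sumr mulr_sumr.
    over.
  rewrite exchange_big /=.
  apply: le_trans (_ : \sum_(f : {ffun 'I_k -> 'I_M})
      (template_prob k p ^+ 2 * (M%:R + y) ^+ k) <= _); last first.
    rewrite sumr_const card_ffun !card_ord -[leLHS]mulr_natl natrX /c /m exprMn.
    rewrite (_ : M%:R + y = (1 + y / M%:R) * M%:R); last first.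
      by rewrite mulrDl mul1r divfK // gt_eqF.
    by rewrite !exprMn [template_prob k p ^+ 2 * _]mulrC -!mulrA mulrCA.
  apply: ler_sum => f _; rewrite exchange_big /=.
  apply: le_trans (_ : \sum_(f' : {ffun 'I_k -> 'I_M}) template_prob k p ^+ 2 *
     \prod_(a : 'I_k) (if f a == f' a then y else 1) <= _).
    apply: ler_sum => f' _.
    apply: le_trans (@induces2_prob n k M le_n f f' p s p01 s0 s2).
    apply: ler_sum => g _.
    by do 2 case: induces => /=; rewrite ?mulr0n ?mulr1n ?mul0r ?mulr0 ?mulr1.
  by rewrite -mulr_sumr ler_wpM2l ?exprn_ge0 ?(ltW t0) // sum_agree // ltW.
(* 1[Z > 0] >= 2 l Z - l^2 Z^2 for every l; take l = 1 / (c m) *)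
pose l := (c * m)^-1.
have lg : 0 < l by rewrite invr_gt0 mulr_gt0.
apply: le_trans (_ : \sum_(g : graph n | canonical_graph g)
   gnp_weight p g * (2 * l * Z g - l ^+ 2 * Z g ^+ 2) <= _); last first.
  apply: ler_sum => g _; rewrite -[X in _ <= X *+ _]mulr1 -mulrnAr.
  apply: ler_wpM2l; first by apply: gnp_weight_ge0; rewrite !ltW.
  case: existsP => [_|ne] /=.
    rewrite -subr_ge0 (_ : _ - _ = (l * Z g - 1) ^+ 2) ?sqr_ge0 //.
    by rewrite sqrrB1 exprMn opprB addrC -[(l * Z g) *+ 2]mulr_natl mulrA.
  rewrite (_ : Z g = 0) ?expr2 ?mulr0 ?subrr //.
  apply: big1 => f _; case h: (induces _ _ _) => //.
  by case: ne; exists f.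
under eq_bigr => g _ do
  rewrite mulrBr [X in X - _]mulrCA [X in _ - X]mulrCA.
rewrite sumrB -!mulr_sumr EZ.
apply: le_trans (_ : 2 * l * m - l ^+ 2 * (c * m ^+ 2) <= _); last first.
  by rewrite lerD2l lerN2 ler_wpM2l // exprn_ge0 // ltW.
have lcm : l * (c * m) = 1 by rewrite mulVf // gt_eqF // mulr_gt0.
have lm : l * m = c^-1 by rewrite /l invfM -mulrA mulVf ?mulr1 // gt_eqF.
have -> : l ^+ 2 * (c * m ^+ 2) = l * m.
  by rewrite !expr2 [c * _]mulrA mulrACA lcm mul1r.
by rewrite -mulrA lm mulr_natl mulr2n addrK.
Qed.

(** * The template is a diameter graph with chromatic number 4 *)

Local Open Scope R_scope.

Definition vec3 (x y z : R) : 'I_3 -> R :=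
  fun i => match val i with 0%N => x | 1%N => y | _ => z end.

Lemma edist_vec3 x y z x' y' z' :
  edist (vec3 x y z) (vec3 x' y' z') =
  sqrt ((x - x') * (x - x') + (y - y') * (y - y') + (z - z') * (z - z')).
Proof.
by rewrite /edist !big_ord_recl big_ord0 /vec3 /=; congr sqrt; lra.
Qed.

(* Points 0..3 span a regular tetrahedron of side sqrt 2. The others lie on the
   quarter circle x = 1, y^2 + z^2 = 1, y, z > 0: at distance sqrt 2 from point 0
   and closer than that to everything else. *)
Definition place (j : nat) : 'I_3 -> R :=
  match j with
  | 0%N => vec3 0 0 0
  | 1%N => vec3 1 1 0
  | 2%N => vec3 1 0 1
  | 3%N => vec3 0 1 1
  | _ => vec3 1 (sqrt (1 - / INR j * / INR j)) (/ INR j)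
  end.

Lemma place_arc (j : nat) : (4 <= j)%N -> exists y z : R,
  [/\ place j = vec3 1 y z, 0 < y, 0 < z, y * y + z * z = 1 & z = / INR j].
Proof.
move=> j4; have j4' : (4 <= INR j) by have := le_INR 4 j (elimT ssrnat.leP j4); rewrite /=; lra.
exists (sqrt (1 - / INR j * / INR j)), (/ INR j).
have i0 : 0 < / INR j by apply: Rinv_0_lt_compat; lra.
have i1 : / INR j <= / 4 by apply: Rinv_le_contravar; lra.
split=> //; first by case: j j4 {j4' i0 i1} => [|[|[|[|j]]]].
  by apply: sqrt_lt_R0; nra.
by rewrite sqrt_sqrt; nra.
Qed.

(** Here [d] is the squared distance, 2 being the squared diameter. Two arc points have
    [d = 2 - 2 (y y' + z z')], below 2 as all coordinates are positive; an arc point is at [d = 2]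
    from point 0, and at [2 - 2 y], [2 - 2 z], [4 - 2 (y + z)] from points 1, 2, 3. *)
Lemma place_dist (a b : nat) : (a < b)%N ->
  exists d : R, [/\ edist (place a) (place b) = sqrt d, edist (place b) (place a) = sqrt d,
    0 < d <= 2 & template a b <-> d = 2].
Proof.
move=> ab; case: (ltnP b 4) => b4.
  exists 2; case: b ab b4 => [|[|[|[|b]]]] //; case: a => [|[|[|a]]] // _ _;
    by rewrite /= !edist_vec3; split; [congr sqrt; lra|congr sqrt; lra|lra|].
have b4f : (b < 4)%N = false by rewrite ltnNge b4.
have [y [z [-> y0 z0 yz zE]]] := place_arc b4.
case: (ltnP a 4) => a4; last first.
  have [y' [z' [-> y0' z0' yz' zE']]] := place_arc a4.
  rewrite !edist_vec3; 
    eexists; split; [reflexivity|by congr sqrt; lra| |].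
    split; last by nra.
    have lt : INR a < INR b by apply: lt_INR; apply/ssrnat.ltP.
    have a0 : 0 < INR a by apply: lt_0_INR; apply/ssrnat.ltP; apply: leq_trans a4.
    (* Distinct indices give distinct heights [/ INR j], hence a positive distance. *)
    have : z' <> z by rewrite zE zE' => /Rinv_eq_reg e; lra.
    move=> /Rminus_eq_contra/Rlt_0_sqr; rewrite /Rsqr => zz.
    by have := Rle_0_sqr (y' - y); rewrite /Rsqr; lra.
  rewrite /template; have -> : (a == 0)%N = false by case: (a) a4.
  by rewrite b4f /=; split=> // e; exfalso; nra.
have y1 : y < 1 by nra.
have z1 : z < 1 by nra.
(* This keeps the arc closer than the diameter to point 3. *)
have yz1 : 1 < y + z by nra.
case: a {ab} a4 => [|[|[|[|a]]]] //= _; rewrite !edist_vec3; eexists;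
  (split; [reflexivity|by congr sqrt; lra|nra|]).
all: rewrite /template /= ?b4f /=; split=> // e; first [lra | exfalso; nra].
Qed.

Lemma induces_adj n k M (le_n : (k * M <= n)%N) f (g : graph n) (a b : 'I_k) :
  induces le_n f g -> (a < b)%N -> adj g (emb le_n f a) (emb le_n f b) = template a b.
Proof.
move=> /forall_inP h ab; rewrite /adj emb_lt ab.
have /h/eqP -> : (emb le_n f a, emb le_n f b) \in emb_pairs le_n f.
  by apply/imsetP; exists (a, b); rewrite ?inE.
by rewrite /block_template !emb_div.
Qed.

Lemma adj_sym n (g : graph n) i j : adj g i j = adj g j i.
Proof. by rewrite /adj; case: ltngtP. Qed.

Lemma adj_irr n (g : graph n) i : adj g i i = false.
Proof. by rewrite /adj ltnn. Qed.

Lemma event_u'_u d n k (g : graph n) : event_u' d k g -> event_u d k g.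
Proof. by move=> [W [? [? [? _]]]]; exists W. Qed.

(** On the picked vertices [v %/ M] is the block, so placement and colouring are both defined
    through this quotient. *)
Lemma induces_event n k M (le_n : (k * M <= n)%N) f (g : graph n) :
  (4 <= k)%N -> induces le_n f g -> event_u' 3 k g.
Proof.
move=> k4 gf; pose W := [set emb le_n f a | a : 'I_k].
have adjE (a b : 'I_k) : (a < b)%N -> adj g (emb le_n f a) (emb le_n f b) = template a b.
  exact: induces_adj.
have inW (a : 'I_k) : emb le_n f a \in W by apply: imset_f.
have emb_inj : injective (emb le_n f) by move=> a b /emb_inj2[].
exists W; split; first by rewrite card_imset // card_ord.
have distE (a b : 'I_k) : a <> b -> exists d : R,
    [/\ edist (place a) (place b) = sqrt d, 0 < d <= 2 &
    adj g (emb le_n f a) (emb le_n f b) <-> d = 2].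
  move=> ab; case: (ltngtP a b) => [lt|lt|/val_inj //].
    by have [d [e _ d2 t]] := place_dist lt; exists d; rewrite adjE.
  by have [d [_ e d2 t]] := place_dist lt; exists d; rewrite adj_sym adjE.
have edist0 (x : 'I_3 -> R) : edist x x = 0.
  rewrite /edist big1 ?sqrt_0 // => i _; lra.
have s2 : 0 < sqrt 2 by apply: sqrt_lt_R0; lra.
have sqrt_eq2 d : 0 < d <= 2 -> sqrt d = sqrt 2 <-> d = 2.
  by move=> d0; split=> [/sqrt_inj|->] //; apply; lra.
pose o (i : nat) (hi : (i < 4)%N) : 'I_k := Ordinal (leq_trans hi k4).
split; last split.
- exists (fun v => place (v %/ M)); split.
    move=> _ _ /imsetP[a _ ->] /imsetP[b _ ->]; rewrite !emb_div => e.
    case: (a =P b) => [-> //|/distE[d [e' d0 _]]].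
    move: e'; rewrite e edist0 => /esym.
    by have := sqrt_lt_R0 d; lra.
  exists (sqrt 2); split; last split.
  + move=> _ _ /imsetP[a _ ->] /imsetP[b _ ->]; rewrite !emb_div.
    case: (a =P b) => [->|/distE[d [-> d0 _]]]; first by rewrite edist0; lra.
    by apply: sqrt_le_1_alt; lra.
  + exists (emb le_n f (o 0%N isT)), (emb le_n f (o 1%N isT)); split=> //; split=> //.
    by rewrite !emb_div /= edist_vec3; congr sqrt; lra.
  + move=> _ _ /imsetP[a _ ->] /imsetP[b _ ->] ne; rewrite !emb_div.
    have /distE[d [-> d0 ->]] : a <> b by move=> e; apply: ne; rewrite e.
    by rewrite sqrt_eq2.
- split.
    (* A block from 4 on is adjacent only to the apex, which has colour 0, so colour 1 is free for
       all of them. *)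
    exists (fun v => if (v %/ M < 4)%N then (v %/ M)%N else 1%N).
    split=> [v _|_ _ /imsetP[a _ ->] /imsetP[b _ ->]]; first by case: ifP.
    rewrite !emb_div.
    wlog ab : a b / (a < b)%N.
      move=> H; case: (ltngtP a b) => [|lt|/val_inj ->]; [exact: H| |by rewrite adj_irr].
      by rewrite adj_sym => /(H _ _ lt) ne e; apply: ne.
    rewrite adjE // /template => /orP[/eqP a0|b4].
      by rewrite a0; case: ifP => // _ b0; rewrite a0 -b0 in ab.
    by rewrite b4 (ltn_trans ab b4) => e; rewrite e ltnn in ab.
  move=> m [c [cm cne]].
  have lt (i : 'I_4) : (c (emb le_n f (o i (ltn_ord i))) < m)%N by apply: cm.
  pose h (i : 'I_4) : 'I_m := Ordinal (lt i).
  (* Blocks 0 to 3 form a K_4, so any proper colouring is injective on them. *)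
  have h_inj : injective h.
    move=> i j /(congr1 val) /= e; apply/eqP/negPn/negP => ij.
    suff A : adj g (emb le_n f (o i (ltn_ord i))) (emb le_n f (o j (ltn_ord j))).
      by apply: (cne _ _ _ _ A).
    case: (ltngtP i j) => [ij'|ij'|/val_inj ij']; last by rewrite ij' eqxx in ij.
      by rewrite adjE // /template /= ltn_ord orbT.
    by rewrite adj_sym adjE // /template /= ltn_ord orbT.
  by have := leq_card h h_inj; rewrite !card_ord.
- pose r (x y : 'I_n) := [&& x \in W, y \in W & adj g x y].
  (* The apex, in block 0, is adjacent to every other picked vertex. *)
  have star (a : 'I_k) : connect r (emb le_n f (o 0%N isT)) (emb le_n f a).
    case: (posnP a) => a0.
      by rewrite (_ : a = o 0%N isT) ?connect0 //; apply: val_inj.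
    by apply: connect1; rewrite /r !inW adjE.
  have rs : connect_sym r.
    by apply: sym_connect_sym => x y; rewrite /r adj_sym andbCA.
  move=> _ _ /imsetP[a _ ->] /imsetP[b _ ->].
  by apply: connect_trans (star b); rewrite rs star.
Qed.

(** * From probabilities of events to lower bounds on [u] and [u'] *)

Lemma le_u_of_prob d n k p : (k <= n)%N -> (1/2) < gnp_prob p (@event_u d n k) ->
  (k <= u d n p)%N.
Proof.
move=> kn h; rewrite -ltnS in kn; rewrite /u.
have := leq_bigmax (F := fun k : 'I_n.+1 => if Rlt_dec (1/2) (gnp_prob p (@event_u d n k)) then val k else 0%N) (Ordinal kn).
by case: Rlt_dec.
Qed.

Lemma le_u'_of_prob d n k p : (k <= n)%N -> (1/2) < gnp_prob p (@event_u' d n k) ->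
  (k <= u' d n p)%N.
Proof.
move=> kn h; rewrite -ltnS in kn; rewrite /u'.
have := leq_bigmax (F := fun k : 'I_n.+1 => if Rlt_dec (1/2) (gnp_prob p (@event_u' d n k)) then val k else 0%N) (Ordinal kn).
by case: Rlt_dec.
Qed.

Lemma gnp_prob_ge n p (b : graph n -> bool) (E : graph n -> Prop) : 0 < p < 1 ->
  (forall g, b g -> E g) ->
  (\sum_(g : graph n | canonical_graph g) gnp_weight p g *+ b g)%R <= gnp_prob p E.
Proof.
move=> [p0 p1] bE; apply/RleP; apply: (@ler_sum R) => g _.
have w0 : (0 <= gnp_weight p g)%R.
  by apply: gnp_weight_ge0; apply/andP; split; apply/RleP; apply: Rlt_le.
destruct (excluded_middle_informative (E g)) as [e|ne]; first by case: (b g).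
by case h: (b g) => //; case: ne; apply: bE.
Qed.

(** * Asymptotics *)

Lemma nat_ceil (x : R) : 0 <= x -> exists k : nat, x <= INR k <= x + 1.
Proof.
move=> x0; have [up1 up2] := archimed x.
exists (Z.to_nat (up x)).
rewrite INR_IZR_INZ Z2Nat.id; first by lra.
by apply: le_IZR; lra.
Qed.

Lemma ln_le_sub1 (x : R) : 0 < x -> ln x <= x - 1.
Proof. by move=> x0; have := exp_ineq1_le (ln x); rewrite exp_ln //; lra. Qed.

(** [U] is a small power of n dominating 1/p, 1/q and ln n, with [U ^ 26] equal to n^(eps/2). Taking
    k just above (2 - eps) L costs a bounded power of q, so n p^4 q^(k/2) is at least p^4 q^3
    [U ^ 26], hence at least [U ^ 19]; this beats 4 k^2, which is of order [U ^ 4]. Finally n <= 2 k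
    M turns n into M. *)
Lemma size_choice (n : nat) (p eps U : R) :
  0 < p < 1 -> 0 < eps <= 1 -> 0 < INR n -> U = exp (eps / 52 * ln (INR n)) ->
  200 <= U -> 1 <= p * U -> 1 <= (1 - p) * U -> ln (INR n) <= U ->
  let L := ln (INR n * p) / ln (1 / (1 - p)) in
  0 <= L /\
  exists k M : nat, [/\ (4 <= k)%N, (0 < M)%N, (k * M <= n)%N,
    (2 - eps) * L <= INR k &
    2 * INR k <= INR M * (p ^ 4 * sqrt (1 - p) ^ k)].
Proof.
move=> p01 e01 n0 UE U200 pU qU lnU L.
set q := 1 - p in qU L *; have q01 : 0 < q < 1 by rewrite /q; lra.
have lnn0 : 0 < ln (INR n).
  have : exp 0 < exp (eps / 52 * ln (INR n)) by rewrite -UE exp_0; lra.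
  by move/exp_lt_inv; nra.
have U26 : U ^ 26 = exp (eps / 2 * ln (INR n)).
  rewrite UE -Rpower_pow; last exact: exp_pos.
  by rewrite /Rpower ln_exp; congr exp; rewrite /=; field.
have nU : U ^ 26 <= INR n.
  rewrite U26 -[X in _ <= X]exp_ln //.
  have [lt|->] : eps / 2 * ln (INR n) < ln (INR n) \/ eps / 2 * ln (INR n) = ln (INR n) by nra.
    by apply: Rlt_le; apply: exp_increasing.
  exact: Rle_refl.
have Upow m : (1 <= U ^ m) by apply: pow_R1_Rle; lra.
have np1 : 1 <= INR n * p.
  have := Upow 25%N; rewrite (_ : U ^ 26 = U * U ^ 25) // in nU.
  by nra.
have lnnp0 : 0 <= ln (INR n * p).
  rewrite -ln_1; have [lt|<-] : 1 < INR n * p \/ 1 = INR n * p by lra.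
    by apply: Rlt_le; apply: ln_increasing; lra.
  exact: Rle_refl.
have lnnp : ln (INR n * p) <= ln (INR n).
  by apply: Rlt_le; apply: ln_increasing; nra.
have lq : ln (1 / q) = - ln q by rewrite /Rdiv Rmult_1_l ln_Rinv; lra.
have lqp : p <= - ln q by have := @ln_le_sub1 q; rewrite /q; lra.
have LE : L * - ln q = ln (INR n * p) by rewrite /L lq; field; lra.
have L0 : 0 <= L by rewrite /L lq; apply: Rle_mult_inv_pos; lra.
(* From p <= - ln q one gets L p <= ln (np) <= U, and 1/p <= U. *)
have LU : L <= U * U.
  have h1 : L * p <= U.
    by have := Rmult_le_compat_l L _ _ L0 lqp; lra.
  have h2 := Rmult_le_compat_r U _ _ (ltac:(lra)) h1.
  by have := Rmult_le_compat_l L _ _ L0 pU; lra.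
split=> //.
have [k0 [k1 k2]] : exists k : nat, (2 - eps) * L <= INR k <= (2 - eps) * L + 1.
  by apply: nat_ceil; nra.
(* Adding 4 makes room for the K_4 even when [L] is 0. *)
pose k := (k0 + 4)%N; pose M := (n %/ k)%N.
have kE : INR k = INR k0 + 4 by rewrite /k plus_INR /=; lra.
have kU : INR k <= 3 * (U * U) by nra.
have kpos : 4 <= INR k by have := pos_INR k0; lra.
have U2n : 2 * INR k <= INR n.
  have := Upow 23%N; rewrite (_ : U ^ 26 = U * U * (U * U ^ 23)) in nU; last by rewrite /=; ring.
  move=> h; have : 200 <= U * U ^ 23 by nra.
  by nra.
have nM : INR n <= 2 * (INR k * INR M).
  have : (n <= k * M + k)%N.
    by rewrite {1}(divn_eq n k) mulnC leq_add2l ltnW // ltn_mod /k addn4.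
  by move/ssrnat.leP/le_INR; rewrite plus_INR mult_INR; lra.
have Mpos : 0 < INR M by nra.
have s0 : 0 < sqrt q by apply: sqrt_lt_R0; lra.
(* Rounding up and the extra 4 cost at most q^(5/2), which is at least q^3. *)
have sk : q ^ 3 * U ^ 26 <= INR n * sqrt q ^ k.
  have lns : ln (sqrt q) = ln q / 2.
    by rewrite -Rpower_sqrt ?ln_Rpower; lra.
  rewrite -(Rpower_pow k) // /Rpower lns U26 -Rpower_pow; last lra.
  rewrite /Rpower -{2}(exp_ln (INR n)) // -!exp_plus.
  have h : INR 3 * ln q + eps / 2 * ln (INR n) <= ln (INR n) + INR k * (ln q / 2).
    rewrite [INR 3]/= kE.
    have : INR k0 * - ln q <= (2 - eps) * ln (INR n) + - ln q.
      apply: Rle_trans (_ : ((2 - eps) * L + 1) * - ln q <= _); first by nra.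
      by rewrite Rmult_plus_distr_r Rmult_assoc LE; nra.
    by lra.
  have [lt|->] := h; last exact: Rle_refl.
  by apply: Rlt_le; apply: exp_increasing.
exists k, M; split.
- by rewrite /k addn4.
- by apply/ssrnat.ltP; apply: INR_lt.
- by rewrite mulnC leq_trunc_div.
- by lra.
have p4 : 1 <= (p * U) ^ 4 by apply: pow_R1_Rle.
have q3 : 1 <= (q * U) ^ 3 by apply: pow_R1_Rle.
set S := sqrt q ^ k in sk *.
have S0 : 0 < S by apply: pow_lt.
have p40 : 0 < p ^ 4 by apply: pow_lt; lra.
have pq : U ^ 19 <= p ^ 4 * (q ^ 3 * U ^ 26).
  rewrite (_ : p ^ 4 * (q ^ 3 * U ^ 26) = (p * U) ^ 4 * (q * U) ^ 3 * U ^ 19); last by ring.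
  have := Upow 19%N; have : 1 <= (p * U) ^ 4 * (q * U) ^ 3 by nra.
  by move: (_ * _) (U ^ 19) => a b; nra.
have h1 : U ^ 19 <= INR n * (p ^ 4 * S).
  apply: Rle_trans pq _.
  rewrite (_ : INR n * (p ^ 4 * S) = p ^ 4 * (INR n * S)); last by ring.
  by apply: Rmult_le_compat_l => //; lra.
have h2 : U ^ 19 <= 2 * INR k * (INR M * (p ^ 4 * S)).
  apply: Rle_trans h1 _.
  rewrite (_ : 2 * INR k * (INR M * (p ^ 4 * S)) = 2 * (INR k * INR M) * (p ^ 4 * S)); last by ring.
  by apply: Rmult_le_compat_r => //; nra.
have h3 : 2 * INR k * (2 * INR k) <= U ^ 19.
  apply: Rle_trans (_ : 36 * (U * U * (U * U)) <= _); first by nra.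
  rewrite (_ : U ^ 19 = U * U ^ 14 * (U * U * (U * U))); last by ring.
  apply: Rmult_le_compat_r; first by nra.
  by have := Upow 14%N; nra.
apply: (Rmult_le_reg_l (2 * INR k)); lra.
Qed.

(** The power is at most exp (k x), hence at most exp (1/2), whose square is at most 3 < 4. *)
Lemma pow_add1_lt2 (x : R) (k : nat) : 0 <= x -> 2 * (INR k * x) <= 1 -> (1 + x) ^ k < 2.
Proof.
move=> x0 kx.
have h : (1 + x) ^ k <= exp (INR k * x).
  rewrite -{2}(ln_exp x) -/(Rpower (exp x) (INR k)) Rpower_pow; last exact: exp_pos.
  by apply: pow_incr; have := exp_ineq1_le x; lra.
apply: Rle_lt_trans h _.
have e2 : exp (1 / 2) * exp (1 / 2) <= 3.
  rewrite -exp_plus (_ : 1 / 2 + 1 / 2 = 1); last by lra.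
  exact: exp_le_3.
have e0 := exp_pos (1 / 2).
apply: Rle_lt_trans (_ : exp (1 / 2) < 2); last by nra.
have [lt|->] : INR k * x < 1 / 2 \/ INR k * x = 1 / 2 by lra.
  by apply: Rlt_le; apply: exp_increasing.
exact: Rle_refl.
Qed.

(** The numerical hypothesis says 2 k x <= 1 for x = Y / M, so the second moment bound exceeds 1/2.
    The connected event implies the other one, so a single estimate serves both conclusions. *)
Lemma le_u3 (n k M : nat) (p : R) :
  0 < p < 1 -> (4 <= k)%N -> (0 < M)%N -> (k * M <= n)%N ->
  2 * INR k <= INR M * (p ^ 4 * sqrt (1 - p) ^ k) ->
  (k <= u 3 n p)%N /\ (k <= u' 3 n p)%N.
Proof.
move=> p01 k4 M0 le_n hk.
set s := sqrt (1 - p) in hk.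
have s0 : 0 < s by apply: sqrt_lt_R0; lra.
have d0 : 0 < p ^ 4 * s ^ k by apply: Rmult_lt_0_compat; apply: pow_lt; lra.
have M0' : 0 < INR M by apply: lt_0_INR; apply/ssrnat.ltP.
have x0 : 0 < / (p ^ 4 * s ^ k) / INR M.
  by apply: Rdiv_lt_0_compat => //; apply: Rinv_0_lt_compat.
set b := fun g : graph n => [exists f : {ffun 'I_k -> 'I_M}, induces le_n f g].
have hsum : 1 / 2 < (\sum_(g : graph n | canonical_graph g) gnp_weight p g *+ b g)%R.
  apply: Rlt_le_trans (_ : / (1 + / (p ^ 4 * s ^ k) / INR M) ^ k <= _).
    rewrite [1 / 2]Rmult_1_l; apply: Rinv_lt_contravar.
      by apply: Rmult_lt_0_compat; first apply: pow_lt; lra.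
    apply: pow_add1_lt2; first exact: Rlt_le.
    apply: (Rmult_le_reg_r (INR M * (p ^ 4 * s ^ k))); first by apply: Rmult_lt_0_compat.
    rewrite (_ : 2 * _ * _ = 2 * INR k); first by rewrite Rmult_1_l.
    by move: (p ^ 4 * s ^ k) d0 => d d0; field; lra.
  have := @second_moment n k M le_n p s.
  rewrite -!RpowE -!INRE => H; apply/RleP; apply: H => //.
  - by have [p0 p1] := p01; apply/andP; split; apply/RltP.
  - exact/RltP.
  - by rewrite /= Rmult_1_r; apply: sqrt_sqrt; lra.
have bE g : b g -> event_u' 3 k g by case/existsP => f; apply: induces_event.
have kn : (k <= n)%N by apply: (leq_trans _ le_n); rewrite leq_pmulr.
split; [apply: le_u_of_prob => //|apply: le_u'_of_prob => //];
  apply: Rlt_le_trans hsum _; apply: gnp_prob_ge => // g /bE //.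
exact: event_u'_u.
Qed.

Theorem theorem22 (p : nat -> R)
  (hp : forall n : nat, (0 <= p n <= 1))
  (hpa : forall a : R, (0 < a) -> forall M : R, exists N : nat,
           forall n : nat, (N <= n)%N -> (M < p n * Rpower (INR n) a))
  (hq : forall M : R, exists N : nat,
           forall n : nat, (N <= n)%N -> (M < (1 - p n) * ln (INR n))) :
  forall eps : R, (0 < eps) -> exists n0 : nat, forall n : nat, (n0 <= n)%N ->
    ((2 - eps) * (ln (INR n * p n) / ln (1 / (1 - p n))) <= INR (u 3 n (p n))) /\
    ((2 - eps) * (ln (INR n * p n) / ln (1 / (1 - p n))) <= INR (u' 3 n (p n))).
Proof.
(* Lowering [eps] to at most 1 only strengthens the bound, since [L] turns out nonnegative. *)
move=> eps e0; pose e := Rmin eps 1.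
have e01 : 0 < e <= 1 by split; [apply: Rmin_glb_lt; lra|apply: Rmin_r].
have ee : e <= eps by apply: Rmin_l.
pose a := e / 52; have a0 : 0 < a by rewrite /a; lra.
have [N1 h1] := hpa a a0 1.
have [N2 h2] := hq 1.
have [N3 h3] := hq (200 / a + 4 / (a * a)).
(* In the threshold for ln n, the term [200 / a] yields U >= 200 and [4 / (a * a)] yields ln n <= (a
   ln n / 2)^2 <= U. *)
exists (maxn N1 (maxn N2 N3)) => n; rewrite !geq_max => /and3P[/h1 pU /h2 qln /h3 qX].
have a2 : 0 < a * a by nra.
have i1 : 0 < 200 / a by apply: Rdiv_lt_0_compat; lra.
have i2 : 0 < 4 / (a * a) by apply: Rdiv_lt_0_compat; lra.
have [p0 p1] := hp n.
set x := ln (INR n) in qX qln *.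
have x1 : 200 / a + 4 / (a * a) < x by nra.
have ax : 200 < a * x.
  have -> : 200 = a * (200 / a) by field; lra.
  by apply: Rmult_lt_compat_l; lra.
have aax : 4 < a * a * x.
  have -> : 4 = a * a * (4 / (a * a)) by field; lra.
  by apply: Rmult_lt_compat_l; lra.
(* The case n = 0 is excluded because [ln 0] is 0 by convention, contradicting [ax]. *)
have n0 : 0 < INR n.
  have [lt //|nz] := pos_INR n.
  by move: ax; rewrite /x -nz /ln; case: Rlt_dec => [/Rlt_irrefl //|_]; lra.
pose U := exp (a * x).
have U200 : 200 <= U by have := exp_ineq1_le (a * x); rewrite -/U; lra.
have xU : x <= U.
  have half : a * x / 2 <= exp (a * x / 2).
    by have := exp_ineq1_le (a * x / 2); lra.
  have -> : U = exp (a * x / 2) * exp (a * x / 2).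
    by rewrite -exp_plus; congr exp; lra.
  by apply: Rle_trans (_ : a * x / 2 * (a * x / 2) <= _); nra.
(* [Rpower (INR n) a] unfolds to [U]. *)
have pU' : 1 < p n * U by [].
have qU : 1 <= (1 - p n) * U by nra.
have p01 : 0 < p n < 1 by split; nra.
have [L0 [k [M [k4 M0 le_n kL kM]]]] :=
  size_choice p01 e01 n0 (erefl U) U200 (Rlt_le _ _ pU') qU xU.
have [/ssrnat.leP/le_INR ku /ssrnat.leP/le_INR ku'] := le_u3 p01 k4 M0 le_n kM.
set L := ln (INR n * p n) / _ in L0 kL *.
have : (2 - eps) * L <= (2 - e) * L by nra.
by split; lra.
Qed.
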